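(* Let $A\in\mathbb{Z}^{m\times n}$ with $\operatorname{rank}(A)=m<n$, $b\in\mathbb{Z}^m$, $u\in\mathbb{Z}^n$ with $u\ge 0$, and let $(F^B)$ be the system $Ax=b,\ 0\le x\le u,\ x\in\mathbb{Z}^n$. Let $T\in\mathbb{Q}^{1\times m}$ be a strong aggregation matrix of size one for $(F^B)$, and let $\sum_{i=1}^n\alpha_i x_i=\beta$, with $\alpha\in\mathbb{Z}^n$, $\alpha\ge 0$, $\beta\in\mathbb{Z}$, be the corresponding normalized aggregated equation (see context). Then the number $\gamma_\beta$ of solutions of $(F^B)$ is $$\gamma_\beta=\frac{1}{2\pi}\int_{-\pi}^{\pi}\left(\prod_{j=1}^n\frac{1-e^{\imath\alpha_j(u_j+1)\theta}}{1-e^{\imath\alpha_j\theta}}\right)e^{-\imath\beta\theta}\,d\theta .$$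
   Context: $\imath$ is the imaginary unit. For $T\in\mathbb{Q}^{1\times m}$, the aggregated system $(F^B_T)$ is $TAx=Tb,\ 0\le x\le u,\ x\in\mathbb{Z}^n$; $T$ is a strong aggregation matrix for $(F^B)$ if $(F^B)$ and $(F^B_T)$ have the same set of solutions. Normalized aggregated equation: after multiplying $T$ by a positive integer, one may take $\alpha'=TA\in\mathbb{Z}^n$ and $\beta'=Tb\in\mathbb{Z}$; since $x$ is bounded, each variable $x_i$ with $\alpha'_i<0$ is replaced by $u_i-x_i$, which gives $\alpha_i=|\alpha'_i|$ and $\beta=\beta'-\sum_{i:\alpha'_i<0}\alpha'_i u_i$ (if $\alpha'\ge 0$, simply $\alpha=\alpha'$ and $\beta=\beta'$). Where the denominator vanishes, the quotient $\frac{1-e^{\imath\alpha_j(u_j+1)\theta}}{1-e^{\imath\alpha_j\theta}}$ is understood as the finite geometric sum $\sum_{k=0}^{u_j}e^{\imath k\alpha_j\theta}$. *)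

(* Defs.v *)
From HB Require Import structures.
From mathcomp Require Import all_boot all_order all_algebra finmap.
From mathcomp Require Import all_classical all_reals all_analysis.
From mathcomp Require Import complex.

Set Implicit Arguments.
Unset Strict Implicit.
Unset Printing Implicit Defensive.

Import Order.TTheory GRing.Theory Num.Theory.
Import numFieldNormedType.Exports.

Local Open Scope classical_set_scope.
Local Open Scope ring_scope.

Section BoundedSystems.
Context {m n : nat}.
Implicit Types (A : 'M[int]_(m, n)) (b : 'cV[int]_m) (u x : 'cV[int]_n).

Definition in_box u x : Prop := forall i, 0 <= x i 0 <= u i 0.

Definition solutions A b u : set 'cV[int]_n :=
  [set x | A *m x = b /\ in_box u x].

Definition aggregated_solutions (T : 'rV[rat]_m) A b u : set 'cV[int]_n :=
  [set x | T *m map_mx intr A *m map_mx intr x = T *m map_mx intr b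
           /\ in_box u x].

Definition strong_aggregation (T : 'rV[rat]_m) A b u : Prop :=
  solutions A b u = aggregated_solutions T A b u.

(* alpha' and beta' are the integer coefficients and right-hand side of the
   aggregated equation once T is multiplied by the positive integer N;
   alpha and beta result from substituting u_i - x_i for each x_i such that
   alpha'_i < 0. *)
Definition normalized_aggregation (T : 'rV[rat]_m) A b u
    (alpha : 'rV[int]_n) (beta : int) : Prop :=
  exists (N : nat) (alpha' : 'rV[int]_n) (beta' : int),
    [/\ (0 < N)%N,
        map_mx intr alpha' = (N%:R *: T) *m map_mx intr A,
        beta'%:~R%:M = (N%:R *: T) *m map_mx intr b,
        alpha = \row_i `|alpha' 0 i| &
        beta = beta' - \sum_(i < n | alpha' 0 i < 0) alpha' 0 i * u i 0].

(* [fset_set] is the empty set on infinite sets, so the cardinality of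
   [fset_set (solutions A b u)] is meaningful because of this fact. *)
Lemma finite_solutions A b u : finite_set (solutions A b u).
Proof.
pose M := (\max_(i < n) `|u i 0%R|)%N.
pose f (g : {ffun 'I_n -> 'I_M.+1}) : 'cV[int]_n := \col_i (g i)%:Z.
apply: (@sub_finite_set _ _ (f @` setT)); last exact/finite_image/finite_finset.
move=> x [_ xu]; exists [ffun i => inord `|x i 0%R|%N] => //.
apply/colP => i; rewrite mxE ffunE.
have /andP[x0 xui] := xu i.
rewrite inordK ?gez0_abs// ltnS.
apply: leq_trans (leq_bigmax i).
by rewrite -lez_nat !gez0_abs// (le_trans x0).
Qed.

End BoundedSystems.

Section ComplexAnalysis.
Context {R : realType}.
Local Open Scope complex_scope.

Definition cexp (z : R[i]) : R[i] :=
  (expR (complex.Re z))%:C * (cos (complex.Im z) +i* sin (complex.Im z)).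

Definition cintegral (D : set R) (f : R -> R[i]) : R[i] :=
  (\int[lebesgue_measure]_(t in D) complex.Re (f t))
  +i* (\int[lebesgue_measure]_(t in D) complex.Im (f t)).

(* (1 - e^(i a (v + 1) t)) / (1 - e^(i a t)), read as the geometric sum
   where the denominator vanishes; it is only meant for 0 <= v, so that
   `|v| is v as a natural number. *)
Definition geometric_quotient (a v : int) (t : R) : R[i] :=
  if 1 - cexp ('i * (a%:~R * t)%:C) == 0 then
    \sum_(0 <= k < `|v|%N.+1) cexp ('i * (k%:R * a%:~R * t)%:C)
  else
    (1 - cexp ('i * (a%:~R * (v + 1)%:~R * t)%:C))
    / (1 - cexp ('i * (a%:~R * t)%:C)).

End ComplexAnalysis.

(* Main.v *)
Require Import Defs.
From HB Require Import structures.
From mathcomp Require Import all_boot all_order all_algebra finmap.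
From mathcomp Require Import all_classical all_reals all_analysis.
From mathcomp Require Import complex.
From mathcomp Require Import ring zify.

Set Implicit Arguments.
Unset Strict Implicit.
Unset Printing Implicit Defensive.

Import Order.TTheory GRing.Theory Num.Theory.
Import numFieldNormedType.Exports.

Local Open Scope classical_set_scope.
Local Open Scope ring_scope.

(** Expanding each quotient as the geometric sum of the e^{i k a_j t} with
    0 <= k <= u_j, and then the product of these sums, turns the integrand
    into the sum of the exponentials e^{i (alpha y - beta) t}, y ranging over
    the integer points of the box 0 <= y <= u
    ([generating_function_expansion]).  On [-pi, pi] an exponential of nonzero
    integer frequency integrates to 0 and the constant 1 to 2 pi, so the
    integral is 2 pi times the number of box points on the hyperplane
    alpha y = beta ([cintegral_exponential_sum]).

    That number is the number of solutions of A x = b, 0 <= x <= u: because T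
    is a strong aggregation matrix these are the box points satisfying the
    single aggregated equation alpha' x = beta', and replacing x_i by
    u_i - x_i where alpha'_i < 0 is an involution of the box which carries
    alpha' x = beta' to alpha y = beta ([solutions_reflect]). *)

(** * Exponentials on the unit circle *)

Section UnitCircle.
Context {R : realType}.
Local Open Scope complex_scope.
Implicit Types (x y t : R) (a v : int).

Definition cis x : R[i] := cos x +i* sin x.

Lemma cexp_imag x : cexp ('i * x%:C) = cis x.
Proof. by rewrite /cexp /cis; simpc; rewrite expR0; simpc. Qed.

Lemma cexp_imagN x : cexp (- ('i * x%:C)) = cis (- x).
Proof. by rewrite -cexp_imag rmorphN mulrN. Qed.

Lemma cis0 : cis 0 = 1.
Proof. by rewrite /cis cos0 sin0. Qed.

Lemma cisD x y : cis (x + y) = cis x * cis y.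
Proof.
rewrite /cis cosD sinD; simpc.
by congr (_ +i* _); ring.
Qed.

Lemma cisMn x k : cis (k%:R * x) = cis x ^+ k.
Proof.
elim: k => [|k ih]; first by rewrite mul0r cis0.
by rewrite exprS -ih -cisD mulrS mulrDl mul1r.
Qed.

Lemma cis_sum (I : Type) (s : seq I) (P : pred I) (F : I -> R) :
  cis (\sum_(i <- s | P i) F i) = \prod_(i <- s | P i) cis (F i).
Proof. exact: (big_morph _ cisD cis0). Qed.

(** Away from the zeros of the denominator this is the closed form of a
    geometric sum of ratio [cis (a t)]; at these zeros it is the convention
    for the quotient. *)
Lemma geometric_quotientE a v t : 0 <= v ->
  geometric_quotient a v t =
  \sum_(k < `|v|%N.+1) cis ((k%:Z * a)%:~R * t).
Proof.
move=> v0; rewrite /geometric_quotient cexp_imag.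
have E k : cis ((k%:Z * a)%:~R * t) = cis (a%:~R * t) ^+ k.
  by rewrite intrM -mulrA cisMn.
case: eqP => [_|/eqP d0].
  rewrite big_mkord; apply: eq_bigr => k _.
  by rewrite cexp_imag intrM.
under eq_bigr do rewrite E.
have -> : cexp ('i * (a%:~R * (v + 1)%:~R * t)%:C)
    = cis (a%:~R * t) ^+ `|v|%N.+1.
  rewrite cexp_imag -E; congr (cis (_ * t)).
  by rewrite -intrM; congr (_%:~R); lia.
apply: (canLR (mulfK d0)).
by rewrite -opprB subrX1 -mulNr opprB mulrC.
Qed.

End UnitCircle.

(** * Integration over a period *)

Section Orthogonality.
Context {R : realType}.
Notation mu := (@lebesgue_measure R).
Implicit Types (f F : R -> R) (a b : R).

Lemma Rintegral_FTC2 f F a b : a < b -> continuous f ->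
  (forall x : R, is_derive x 1 F (f x)) ->
  \int[mu]_(x in `[a, b]) f x = F b - F a.
Proof.
move=> ab cf dF.
have cF : continuous F.
  by move=> x; apply/differentiable_continuous/derivable1_diffP.
rewrite /Rintegral (@continuous_FTC2 _ f F)//.
- exact/continuous_subspaceT.
- split.
  + by move=> x _.
  + exact/cvg_at_right_filter/cF.
  + exact/cvg_at_left_filter/cF.
- by move=> x _; rewrite derive1E derive_val.
Qed.

Lemma Rintegral_sum_continuous (I : Type) (s : seq I) (P : pred I)
    (f : I -> R -> R) a b : (forall i, continuous (f i)) ->
  \int[mu]_(x in `[a, b]) (\sum_(i <- s | P i) f i x) =
  \sum_(i <- s | P i) \int[mu]_(x in `[a, b]) f i x.
Proof.
move=> cf.
have intf i : mu.-integrable `[a, b] (EFin \o f i).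
  apply: continuous_compact_integrable; first exact: segment_compact.
  exact/continuous_subspaceT.
rewrite /Rintegral; under eq_integral do rewrite -sumEFin.
rewrite integral_sum// -sum_fine// => i _.
by apply: integrable_fin_num => //; exact: intf.
Qed.

Lemma sin_intpi (k : int) : sin (k%:~R * pi) = 0 :> R.
Proof.
have H (l : nat) : sin (l%:R * pi) = 0 :> R.
  elim: l => [|l ih]; first by rewrite mul0r sin0.
  by rewrite mulrS mulrDl mul1r addrC sinDpi ih oppr0.
case: k => l; first exact: H.
by rewrite NegzE mulrNz mulNr sinN H oppr0.
Qed.

Lemma continuous_cosZ (c : R) : continuous (fun t => cos (c * t)).
Proof.
by move=> t; apply: (@continuous_comp _ _ _ ( *%R c) cos);
  [exact: mulrl_continuous | exact: continuous_cos].
Qed.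

Lemma continuous_sinZ (c : R) : continuous (fun t => sin (c * t)).
Proof.
by move=> t; apply: (@continuous_comp _ _ _ ( *%R c) sin);
  [exact: mulrl_continuous | exact: continuous_sin].
Qed.

Lemma Rintegral_cos_period (k : int) :
  \int[mu]_(t in `[- pi, pi]) cos (k%:~R * t) = (2 * pi) *+ (k == 0).
Proof.
have ltpi : - pi < pi :> R by rewrite gtrN ?pi_gt0.
case: eqP => [->|/eqP k0].
  under eq_Rintegral do rewrite mul0r cos0.
  rewrite (@Rintegral_FTC2 _ id) //; last by move=> t; exact: cst_continuous.
  by rewrite opprK mulrDl mul1r.
have k0' : k%:~R != 0 :> R by rewrite intr_eq0.
have dF (t : R) : is_derive t 1 (fun t => k%:~R^-1 * sin (k%:~R * t))
    (cos (k%:~R * t)).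
  apply: is_derive_eq.
  by rewrite /GRing.scale /= mulr1; field.
rewrite (Rintegral_FTC2 ltpi (@continuous_cosZ _) dF).
by rewrite mulrN sinN sin_intpi oppr0 mulr0 subr0.
Qed.

(** The sine is odd, so its even primitive takes the same value at both ends
    of the interval. *)
Lemma Rintegral_sin_period (k : int) :
  \int[mu]_(t in `[- pi, pi]) sin (k%:~R * t) = 0.
Proof.
have ltpi : - pi < pi :> R by rewrite gtrN ?pi_gt0.
have [->|k0] := eqVneq k 0.
  under eq_Rintegral do rewrite mul0r sin0.
  by rewrite (@Rintegral_FTC2 _ (cst 0))// ?subrr// => t; exact: cst_continuous.
have k0' : k%:~R != 0 :> R by rewrite intr_eq0.
have dF (t : R) : is_derive t 1 (fun t => - (k%:~R^-1 * cos (k%:~R * t)))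
    (sin (k%:~R * t)).
  apply: is_derive_eq.
  by rewrite /GRing.scale /= mulr1; field.
rewrite (Rintegral_FTC2 ltpi (@continuous_sinZ _) dF).
by rewrite mulrN cosN subrr.
Qed.

(** Integration over a period extracts the constant term of a trigonometric
    sum, which here counts the indices of zero frequency. *)
Lemma cintegral_exponential_sum (I : finType) (P : pred I) (k : I -> int) :
  cintegral `[- pi, pi] (fun t : R => \sum_(i | P i) cis ((k i)%:~R * t)) =
  ((2 * pi) *+ #|[pred i | P i & k i == 0]|)%:C%C.
Proof.
have ReE (t : R) : complex.Re (\sum_(i | P i) cis ((k i)%:~R * t)) =
    \sum_(i | P i) cos ((k i)%:~R * t) by rewrite raddf_sum.
have ImE (t : R) : complex.Im (\sum_(i | P i) cis ((k i)%:~R * t)) =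
    \sum_(i | P i) sin ((k i)%:~R * t) by rewrite raddf_sum.
rewrite /cintegral; congr (Complex _ _).
- under eq_Rintegral do rewrite ReE.
  rewrite Rintegral_sum_continuous; last by move=> i; exact: continuous_cosZ.
  under eq_bigr do rewrite Rintegral_cos_period.
  rewrite -[RHS]sumr_const; under [RHS]eq_bigl do rewrite inE.
  by rewrite big_mkcondr; apply: eq_bigr => i _; case: eqP.
- under eq_Rintegral do rewrite ImE.
  rewrite Rintegral_sum_continuous; last by move=> i; exact: continuous_sinZ.
  by rewrite big1// => i _; exact: Rintegral_sin_period.
Qed.

End Orthogonality.

(** * Box points and the aggregated equation *)

Section Counting.
Context {n : nat}.
Implicit Types (u x y : 'cV[int]_n) (s : pred 'I_n).

Definition reflect s u x : 'cV[int]_n :=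
  \col_i if s i then u i 0 - x i 0 else x i 0.

Lemma reflectK s u : involutive (reflect s u).
Proof.
by move=> x; apply/colP => i; rewrite !mxE; case: (s i) => //; rewrite subKr.
Qed.

Lemma in_box_reflect s u x : in_box u x -> in_box u (reflect s u x).
Proof.
move=> ux i; have /andP[x0 xu] := ux i.
rewrite mxE; case: (s i); last exact: ux.
by rewrite subr_ge0 xu gerBl.
Qed.

(** The left-hand side of the normalized equation, evaluated at the reflected
    point: each index with [a 0 i < 0] contributes
    - a_i (u_i - x_i) = a_i x_i - a_i u_i. *)
Lemma sum_reflect_neg (a : 'rV[int]_n) u x :
  \sum_i `|a 0 i| * reflect (fun i => a 0 i < 0) u x i 0 =
  \sum_i a 0 i * x i 0 - \sum_(i | a 0 i < 0) a 0 i * u i 0.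
Proof.
rewrite [X in _ - X]big_mkcond -sumrB; apply: eq_bigr => i _.
rewrite mxE; case: ltrP => [/ltr0_norm ->|/ger0_norm ->]; last by rewrite subr0.
by rewrite mulNr mulrBr opprB.
Qed.

(** Clearing the denominators of T by a positive integer N multiplies the
    rational equation by an invertible scalar, and an equality between integers
    may be tested in the rationals. *)
Lemma aggregated_equation m (A : 'M[int]_(m, n)) b (T : 'rV[rat]_m)
    (N : nat) (a : 'rV[int]_n) (c : int) x :
  (0 < N)%N ->
  map_mx intr a = (N%:R *: T) *m map_mx intr A ->
  c%:~R%:M = (N%:R *: T) *m map_mx intr b ->
  (T *m map_mx intr A *m map_mx intr x = T *m map_mx intr b) <->
  (\sum_i a 0 i * x i 0 = c).
Proof.
move=> N0 aE cE.
have N0' : N%:R != 0 :> rat by rewrite pnatr_eq0 -lt0n.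
have -> : (T *m map_mx intr A *m map_mx intr x = T *m map_mx intr b) <->
    map_mx intr (a *m x) = c%:~R%:M :> 'M[rat]_1.
  rewrite map_mxM aE cE -!scalemxAl; split=> [->//|].
  exact/scalerI.
rewrite [a *m x]mx11_scalar map_scalar_mx mxE.
split=> [/matrixP/(_ 0 0)|->//].
by rewrite !mxE !mulr1n => /intr_inj.
Qed.

(** The integer points of the box, as finite functions with values in a common
    ordinal ['I_M] cut down coordinate by coordinate: this is the index set
    that distributing a product over sums produces. *)
Definition box_grid M u : simpl_pred {ffun 'I_n -> 'I_M} :=
  family (fun i (k : 'I_M) => (k < `|u i 0%R|.+1)%N).

Definition grid_point M (f : {ffun 'I_n -> 'I_M}) : 'cV[int]_n :=
  \col_i (f i : nat)%:Z.

(** Once [M] exceeds every bound, [grid_point] is a bijection from the grid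
    onto the integer points of the box. *)
Lemma card_box_image M u (P : pred 'cV[int]_n) (h : 'cV[int]_n -> 'cV[int]_n) :
  (forall i, 0 <= u i 0) -> (forall i, `|u i 0%R| < M)%N -> injective h ->
  #|` fset_set (h @` [set y | in_box u y /\ P y])| =
  #|[pred f : {ffun 'I_n -> 'I_M} | f \in box_grid M u & P (grid_point f)]|.
Proof.
move=> u0 uM hI; set Q := [pred f | _ & _].
have gI : injective (h \o @grid_point M).
  move=> f g /hI /colP fg; apply/ffunP => i; apply: val_inj.
  by have := fg i; rewrite !mxE => -[].
have -> : h @` [set y | in_box u y /\ P y] =
    [set` [fset (h \o @grid_point M) f | f in Q]%fset].
  apply/seteqP; split=> x /=.
    move=> [y [uy Py] <-]; apply/imfsetP => /=.
    (* The default value of [insubd] is never reached, as y_i <= u_i < M. *)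
    pose f : {ffun 'I_n -> 'I_M} :=
      [ffun i => insubd (Ordinal (uM i)) `|y i 0%R|%N].
    have fE i : f i = `|y i 0%R|%N :> nat.
      rewrite ffunE val_insubd ifT//.
      by apply: leq_ltn_trans (uM i); have := uy i; lia.
    have fy : grid_point f = y.
      by apply/colP => i; rewrite mxE fE; have := uy i; lia.
    exists f; last by rewrite /= fy.
    rewrite !inE fy Py andbT; apply/familyP => i; rewrite unfold_in fE.
    by have := uy i; lia.
  case/imfsetP => f /=; rewrite !inE => /andP[/familyP fu Pf] ->.
  exists (grid_point f) => //; split=> // i.
  have := fu i; rewrite unfold_in mxE; have := u0 i.
  move: (nat_of_ord _) (u i 0) => k v; lia.
by rewrite set_fsetK card_imfset//= -cardE.
Qed.

End Counting.

(** * The integral formula *)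

(** The product of the geometric sums is the generating function of
    y |-> alpha y over the box, evaluated on the unit circle; the last factor
    shifts its frequencies so that alpha y = beta becomes frequency 0. *)
Lemma generating_function_expansion (R : realType) (n M : nat)
    (u : 'cV[int]_n) (alpha : 'rV[int]_n) (beta : int) :
  (forall i, 0 <= u i 0) -> (forall i, `|u i 0%R| < M)%N ->
  (fun t : R => (\prod_(j < n) geometric_quotient (alpha 0 j) (u j 0) t)
    * cexp (- ('i * (beta%:~R * t)%:C))%C) =
  fun t =>
  \sum_(f in box_grid M u)
    cis ((\sum_j alpha 0 j * grid_point f j 0 - beta)%:~R * t).
Proof.
move=> u0 uM; apply/funext => t; rewrite cexp_imagN.
have gq j : geometric_quotient (alpha 0 j) (u j 0) t =
    \sum_(k < M | (k < `|u j 0%R|.+1)%N) cis ((k%:Z * alpha 0 j)%:~R * t).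
  rewrite geometric_quotientE//.
  by rewrite (big_ord_widen M (fun k => cis ((k%:Z * alpha 0 j)%:~R * t))).
under eq_bigr do rewrite gq.
rewrite bigA_distr_big_dep big_distrl; apply: eq_bigr => f _ /=.
rewrite -cis_sum -cisD; congr cis.
rewrite -mulr_suml -mulNr -mulrDl; congr (_ * t).
rewrite rmorphB rmorph_sum; congr (_ - _).
by apply: eq_bigr => j _; rewrite mxE mulrC.
Qed.

(** The solution set is a mirror image of the set that the integral counts;
    the mirrored coordinates are those of negative aggregated coefficient. *)
Lemma solutions_reflect (m n : nat) (A : 'M[int]_(m, n)) (b : 'cV[int]_m)
    (u : 'cV[int]_n) (T : 'rV[rat]_m) (alpha : 'rV[int]_n) (beta : int) :
  strong_aggregation T A b u -> normalized_aggregation T A b u alpha beta ->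
  exists s : pred 'I_n, solutions A b u =
    reflect s u @` [set y | in_box u y /\ \sum_i alpha 0 i * y i 0 == beta].
Proof.
move=> -> [N [a [c [N0 aE cE -> ->]]]].
pose s : pred 'I_n := fun i => a 0 i < 0; exists s.
have alphaE x : \sum_i (\row_i `|a 0 i|) 0 i * reflect s u x i 0 =
    \sum_i a 0 i * x i 0 - \sum_(i | a 0 i < 0) a 0 i * u i 0.
  by rewrite -sum_reflect_neg; apply: eq_bigr => i _; rewrite mxE.
apply/seteqP; split=> x.
  move=> [/(aggregated_equation x N0 aE cE) eqx ux].
  exists (reflect s u x); last exact: reflectK.
  by split; [exact: in_box_reflect | rewrite alphaE eqx].
move=> [y [uy /eqP eqy] <-]; split; last exact: in_box_reflect.
apply/(aggregated_equation _ N0 aE cE); move: eqy.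
by rewrite -{1}(reflectK s u y) alphaE => /addIr.
Qed.

Theorem proposition6 (R : realType) (m n : nat)
    (A : 'M[int]_(m, n)) (b : 'cV[int]_m) (u : 'cV[int]_n)
    (rankA : \rank (map_mx intr A : 'M[rat]_(m, n)) = m) (lt_mn : (m < n)%N)
    (u_ge0 : forall i : 'I_n, 0 <= u i 0)
    (T : 'rV[rat]_m) (strongT : strong_aggregation T A b u)
    (alpha : 'rV[int]_n) (beta : int)
    (norm_eq : normalized_aggregation T A b u alpha beta) :
  (#|` fset_set (solutions A b u)|)%:R =
  ((2 * pi)^-1)%:C%C
  * cintegral `[- pi, pi]
      (fun t : R => (\prod_(j < n) geometric_quotient (alpha 0 j) (u j 0) t)
                    * cexp (- ('i * (beta%:~R * t)%:C))%C).
Proof.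
pose M := (\max_(i < n) `|u i 0%R|).+1%N.
have uM i : (`|u i 0%R| < M)%N by rewrite ltnS (leq_bigmax i).
have [s ->] := solutions_reflect strongT norm_eq.
rewrite (card_box_image (fun y => \sum_i alpha 0 i * y i 0 == beta) u_ge0 uM);
  last exact/can_inj/reflectK.
rewrite (generating_function_expansion R alpha beta u_ge0 uM).
rewrite cintegral_exponential_sum -rmorphM mulrnAr mulVf ?rmorph_nat; last first.
  by rewrite mulf_neq0// gt_eqF// pi_gt0.
by congr (_%:R); apply: eq_card => f; rewrite !inE subr_eq0.
Qed.
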